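(* Let $(X,f)$ be a dynamical system and let $Y$ be its measure center. Then $(X,f)$ has the almost specification property if and only if $(Y,f|_Y)$ has the almost specification property.
   Context: A dynamical system $(X,f)$ is a compact metric space $(X,d)$ together with a continuous map $f\colon X\to X$. $\mathbb{N}=\{1,2,\dots\}$, $\mathbb{N}_0=\mathbb{N}\cup\{0\}$. Measure center. A Borel probability measure $\mu$ on $X$ is invariant if $\mu(B)=\mu(f^{-1}(B))$ for all Borel $B$. A subset $S\subset X$ is measure saturated if for every open $U$ with $U\cap S\neq\emptyset$ there is an invariant measure $\mu$ with $\mu(U)>0$; the measure center is the largest measure saturated subset. Almost specification. For $\varepsilon_0>0$, a function $g\colon\mathbb{N}_0\times(0,\varepsilon_0]\to\mathbb{N}$ is a mistake function if for all $\varepsilon\in(0,\varepsilon_0]$ and $n\in\mathbb{N}_0$ we have $g(n,\varepsilon)\le g(n+1,\varepsilon)$ and $\lim_{n\to\infty}g(n,\varepsilon)/n=0$; for $\varepsilon>\varepsilon_0$ set $g(n,\varepsilon)=g(n,\varepsilon_0)$. For $n$ with $g(n,\varepsilon)<n$ let $I(g;n,\varepsilon)=\{A\subset\{0,\dots,n-1\}:|A|\ge n-g(n,\varepsilon)\}$, and for $x\in X$ let $B_n(g;x,\varepsilon)$ be the set of $y\in X$ for which there is $A\in I(g;n,\varepsilon)$ with $\max_{j\in A}d(f^j(x),f^j(y))<\varepsilon$. The system $(X,f)$ has the almost specification property if there exist a mistake function $g$ and a function $k_g\colon(0,\infty)\to\mathbb{N}$ (with $g(n,\varepsilon)<n$ for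 all $n\ge k_g(\varepsilon)$, so that the sets below are defined) such that for any $m\ge1$, any $\varepsilon_1,\dots,\varepsilon_m>0$, any $x_1,\dots,x_m\in X$ and any integers $n_1\ge k_g(\varepsilon_1),\dots,n_m\ge k_g(\varepsilon_m)$, setting $n_0=0$ and $l_j=\sum_{s=0}^{j-1}n_s$ for $j=1,\dots,m$, there is $z\in X$ such that $f^{l_j}(z)\in B_{n_j}(g;x_j,\varepsilon_j)$ for every $j=1,\dots,m$. *)

(* Defs.v *)
From HB Require Import structures.
From mathcomp Require Import all_boot all_order all_algebra.
From mathcomp Require Import all_classical all_reals all_analysis.
Set Implicit Arguments.
Unset Strict Implicit.
Unset Printing Implicit Defensive.
Import Order.TTheory GRing.Theory Num.Theory.
Import numFieldNormedType.Exports.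
Local Open Scope classical_set_scope.
Local Open Scope ring_scope.

(* A subset of a metric space carries the induced distance.  The topology on
   [set_type A] is already the subspace topology. *)
Section induced_metric.
Context (R : realType) (X : metricType R) (A : set X).

Definition induced_mdist (x y : A) : R := mdist (\val x) (\val y).

Lemma induced_mdist_ge0 x y : 0 <= induced_mdist x y.
Proof. exact: mdist_ge0. Qed.

Lemma induced_mdist_positivity x y : induced_mdist x y = 0 -> x = y.
Proof. by move=> /mdist_positivity; exact: val_inj. Qed.

Lemma ball_induced_mdist (x : A) (e : R) :
  ball x e = [set y | induced_mdist x y < e].
Proof.
by apply/seteqP; split => y; rewrite /induced_mdist /ball/= /initial_ball/=
  ballEmdist.
Qed.

HB.instance Definition _ := PseudoMetric_isMetric.Build R (set_type A)
  induced_mdist_ge0 induced_mdist_positivity ball_induced_mdist.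

End induced_metric.

Section restriction.
Context (T : Type) (A : set T) (f : T -> T) (fA : set_fun A A f).

Definition restrict_self (x : A) : A :=
  SigSub (mem_set (fA (set_mem (valP x)))).

End restriction.

(* Measurable types of the library are pointed.  So as not to exclude the empty
   space, the point is a parameter; the Borel sigma-algebra does not depend on
   it. *)
Definition pointed_at (X : Type) (x0 : X) : Type := X.

HB.instance Definition _ (X : topologicalType) (x0 : X) :=
  Topological.copy (pointed_at x0) X.
HB.instance Definition _ (X : topologicalType) (x0 : X) :=
  isPointed.Build (pointed_at x0) x0.

Notation borel_type x0 := (g_sigma_algebraType (@open (pointed_at x0))).

Section measure_center.
Context (R : realType) (X : metricType R) (f : X -> X).

Definition invariant (x0 : X) (mu : probability (borel_type x0) R) : Prop :=
  forall B : set (borel_type x0), measurable B -> mu B = mu (f @^-1` B).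

Definition measure_saturated (S : set X) : Prop :=
  forall U : set X, open U -> U `&` S !=set0 ->
    exists (x0 : X) (mu : probability (borel_type x0) R),
      invariant mu /\ (0 < mu U)%E.

Definition measure_center : set X := \bigcup_(S in measure_saturated) S.

Lemma measure_center_saturated : measure_saturated measure_center.
Proof. by move=> U oU [x [Ux [S sS Sx]]]; apply: (sS U oU); exists x. Qed.

Lemma measure_center_largest (S : set X) :
  measure_saturated S -> S `<=` measure_center.
Proof. by move=> sS x Sx; exists S. Qed.

Lemma measure_center_closed : closed measure_center.
Proof.
apply: measure_center_largest => U oU [x [Ux clx]].
by apply: measure_center_saturated => //; rewrite setIC; apply: clx;
  exact: open_nbhs_nbhs.
Qed.

Lemma measure_center_stable :
  continuous f -> set_fun measure_center measure_center f.
Proof.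
move=> cf x cx; apply: (@measure_center_largest (f @` measure_center)).
  move=> U oU [z [Uz [y cy fyz]]].
  have oV : open (f @^-1` U) by move/continuousP : cf; apply.
  have [|x0 [mu [imu mu0]]] := measure_center_saturated oV.
    by exists y; split; rewrite // /preimage/= fyz.
  exists x0, mu; split => //.
  by rewrite (imu U (@sub_sigma_algebra _ _ (@open (pointed_at x0)) U oU)).
by exists x.
Qed.

End measure_center.

Section almost_specification.
Context (R : realType).

(* [g n e] is only meaningful for 0 < e <= e0; positive naturals are encoded as
   elements of [nat] with a positivity condition. *)
Definition mistake_function (e0 : R) (g : nat -> R -> nat) : Prop :=
  forall e : R, 0 < e <= e0 ->
    [/\ forall n, (0 < g n e)%N,
        forall n, (g n e <= g n.+1 e)%N
      & (fun n : nat => (g n e)%:R / n%:R : R) @ \oo --> (0 : R)].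

Definition extend_mistake (e0 : R) (g : nat -> R -> nat) (n : nat) (e : R) :=
  g n (Num.min e e0).

Definition mistake_sets (g : nat -> R -> nat) (n : nat) (e : R) :
    {set {set 'I_n}} :=
  [set A : {set 'I_n} | (n - g n e <= #|A|)%N]%SET.

(* Distances are nonnegative, so the default value 0 does not affect the
   maximum. *)
Definition mistake_ball (X : metricType R) (f : X -> X)
    (g : nat -> R -> nat) (n : nat) (x : X) (e : R) : set X :=
  [set y | exists2 A : {set 'I_n}, A \in mistake_sets g n e &
     \big[Num.max/0]_(j in A) mdist (iter j f x) (iter j f y) < e].

Definition almost_specification (X : metricType R) (f : X -> X) : Prop :=
  exists (e0 : R) (g0 : nat -> R -> nat) (k : R -> nat),
    let g := extend_mistake e0 g0 in
    [/\ 0 < e0,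
        mistake_function e0 g0,
        forall e, 0 < e ->
          (0 < k e)%N /\ forall n, (k e <= n)%N -> (g n e < n)%N
      & forall (m : nat) (e : 'I_m -> R) (x : 'I_m -> X) (n : 'I_m -> nat),
          (1 <= m)%N -> (forall j, 0 < e j) -> (forall j, (k (e j) <= n j)%N) ->
          exists z : X, forall j : 'I_m,
            mistake_ball f g (n j) (x j) (e j)
              (iter (\sum_(s < m | (s < j)%N) n s)%N f z)].

End almost_specification.

(* Main.v *)
Require Import Defs.
From HB Require Import structures.
From mathcomp Require Import all_boot all_order all_algebra.
From mathcomp Require Import all_classical all_reals all_analysis.
From mathcomp Require Import zify.
Set Implicit Arguments.
Unset Strict Implicit.
Unset Printing Implicit Defensive.
Import Order.TTheory GRing.Theory Num.Theory.
Import numFieldNormedType.Exports.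
Local Open Scope classical_set_scope.
Local Open Scope ring_scope.

(** Both directions rest on one fact about the measure center [Y] of a compact
    system: a closed set [C] disjoint from [Y] is visited with density zero,
    uniformly in the orbit (lemma [visits_sublinear]).  Otherwise some orbit
    segments, of lengths tending to infinity, spend a fixed proportion of time
    in [C].  Averaging along them produces an invariant Borel probability which
    charges every open neighbourhood of [C].  But each point outside [Y] has an
    open neighbourhood that is null for all invariant probabilities, and
    finitely many of those cover the compact set [C].

    The averaging (Krylov-Bogoliubov) is done without duality: the limit of the
    empirical frequencies along an ultrafilter exists for every subset of the
    space and is an invariant finitely additive probability [m].  It is turned
    into a Borel measure by inner approximation of open sets by closed ones and
    then outer approximation by open sets ([exists_invariant_probability]).

    From [X] to [Y].  Given finitely many segments of orbits in [Y], the whole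
    system traces arbitrarily many repetitions of them.  The closure of the set
    of tracing points is thus visited with positive density, so it meets [Y];
    passing to the closure costs a factor 2 in the precision
    ([spec_on_measure_center]).

    From [Y] to [X].  Fix a precision [e] and a block length [N].  The points
    whose first [N] iterates are [e]-close to those of a point of [Y] form an
    open set [U] containing [Y], so all orbits spend all but a sublinear amount
    of time in [U].  An orbit segment of [X] is therefore a concatenation of
    blocks of length at least [N], each followed by an orbit of [Y] up to few
    errors ([cut_blocks]).  Specification in [Y], applied to these blocks,
    traces the given segment with a number of errors that is sublinear in its
    length ([shadowed_sublinear]), and the running maximum of the least
    sufficient numbers of errors is the new mistake function
    ([sublinear_envelope], [spec_on_setT]). *)

(** * Borel regularization of a finitely additive probability *)

Section finitely_additive_probability.
Context (R : realType) (T : Type).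

Definition finitely_additive_probability (m : set T -> R) : Prop :=
  [/\ m setT = 1, forall A, 0 <= m A &
      forall A B, A `&` B = set0 -> m (A `|` B) = m A + m B].

Variable m : set T -> R.
Hypothesis mP : finitely_additive_probability m.

Let m_ge0 A : 0 <= m A. Proof. by case: mP. Qed.

Let mU A B : A `&` B = set0 -> m (A `|` B) = m A + m B.
Proof. by case: mP => _ _; apply. Qed.

Lemma le_fap A B : A `<=` B -> m A <= m B.
Proof.
move=> AB; rewrite -(setDUK AB) mU ?lerDl//.
by rewrite setDE setICA setICr setI0.
Qed.

Lemma fap_set0 : m set0 = 0.
Proof.
have := @mU set0 set0 (set0I _); rewrite set0U => /eqP.
by rewrite -subr_eq0 opprD addrA subrr sub0r oppr_eq0 => /eqP.
Qed.

Lemma fap_subadd A B : m (A `|` B) <= m A + m B.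
Proof.
rewrite -(setDUK (@subsetUl _ A B)) mU.
  by rewrite lerD2l le_fap// => x [[//|//]].
by rewrite setDE setICA setICr setI0.
Qed.

End finitely_additive_probability.

Section regularization.
Local Open Scope ereal_scope.
Context (R : realType) (X : ptopologicalType).

Definition inner_content (m : set X -> R) (A : set X) : \bar R :=
  ereal_sup [set (m K)%:E | K in [set K | closed K /\ K `<=` A]].

Definition outer_content (m : set X -> R) (A : set X) : \bar R :=
  ereal_inf [set inner_content m U | U in [set U | open U /\ A `<=` U]].

Hypotheses (hX : hausdorff_space X) (cX : compact [set: X]).
Variable m : set X -> R.
Hypothesis mP : finitely_additive_probability m.

Let mU A B : A `&` B = set0 -> m (A `|` B) = (m A + m B)%R.
Proof. by case: mP => _ _; apply. Qed.

Local Notation lambda := (inner_content m).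

Lemma inner_content_ge (K A : set X) :
  closed K -> K `<=` A -> (m K)%:E <= lambda A.
Proof. by move=> cK KA; apply: ereal_sup_ubound; exists K. Qed.

Lemma inner_content_le A x :
  (forall K : set X, closed K -> K `<=` A -> (m K)%:E <= x) -> lambda A <= x.
Proof. by move=> h; apply: ge_ereal_sup => _ [K [cK KA] <-]; exact: h. Qed.

Lemma inner_content_ge0 A : 0 <= lambda A.
Proof.
by have := inner_content_ge closed0 (@sub0set _ A); rewrite fap_set0.
Qed.

Lemma le_inner_content A B : A `<=` B -> lambda A <= lambda B.
Proof.
move=> AB; apply: inner_content_le => K cK KA.
by apply: inner_content_ge => //; exact: subset_trans AB.
Qed.

Lemma inner_content_le1 A : lambda A <= 1.
Proof.
apply: inner_content_le => K cK _; rewrite lee_fin.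
by case: mP => <- _ _; exact: le_fap.
Qed.

Lemma outer_content_le (A U : set X) :
  open U -> A `<=` U -> outer_content m A <= lambda U.
Proof. by move=> oU AU; apply: ereal_inf_lbound; exists U. Qed.

Lemma outer_content_ge A x :
  (forall U : set X, open U -> A `<=` U -> x <= lambda U) ->
  x <= outer_content m A.
Proof. by move=> h; apply: le_ereal_inf_tmp => _ [K [cK KA] <-]; exact: h. Qed.

Lemma outer_content_open (U : set X) : open U -> outer_content m U = lambda U.
Proof.
move=> oU; apply/eqP; rewrite eq_le outer_content_le//=.
by apply: outer_content_ge => V _; exact: le_inner_content.
Qed.

(** Normality splits a closed subset of a union of two open sets into two
    closed pieces, one inside each: this is what makes [inner_content]
    subadditive on open sets. *)
Lemma closed_split (K U V : set X) :
  closed K -> open U -> open V -> K `<=` U `|` V ->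
  exists K1 K2 : set X, [/\ closed K1, closed K2, K1 `<=` U, K2 `<=` V
    & K `<=` K1 `|` K2].
Proof.
move=> cK oU oV KUV.
have /(@normal_openP R) nX := compact_normal hX cX.
have [|||U' [V' [oU' oV' KU' KV' UV']]] := nX (K `\` U) (K `\` V).
- by apply: closedI => //; exact: open_closedC.
- by apply: closedI => //; exact: open_closedC.
- rewrite -subset0 => x [[Kx Ux] [_ Vx]]; by case: (KUV _ Kx).
exists (K `\` U'), (K `\` V'); split.
- by apply: closedI => //; exact: open_closedC.
- by apply: closedI => //; exact: open_closedC.
- by move=> x [Kx U'x]; apply: contrapT => Ux; apply: U'x; apply: KU'.
- by move=> x [Kx V'x]; apply: contrapT => Vx; apply: V'x; apply: KV'.
move=> x Kx; have [U'x|] := pselect (U' x); last by left.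
by right; split=> // V'x; have : (U' `&` V') x by []; rewrite UV'.
Qed.

Lemma fap_le_sum_inner (U : nat -> set X) : (forall i, open (U i)) ->
  forall N (K : set X), closed K -> K `<=` \bigcup_(i < N) U i ->
  (m K)%:E <= \sum_(0 <= i < N) lambda (U i).
Proof.
move=> oU; elim=> [K cK|N IH K cK].
  by rewrite bigcup_mkord !big_ord0 big_nil subset0 => ->; rewrite fap_set0.
rewrite bigcup_mkord big_ord_recr/= -bigcup_mkord => KU.
have [|K1 [K2 [cK1 cK2 K1U K2U K12]]] := closed_split cK _ (oU N) KU.
  exact: bigcup_open.
rewrite big_nat_recr//=; apply: (@le_trans _ _ ((m K1)%:E + (m K2)%:E)).
  by rewrite -EFinD lee_fin (le_trans _ (fap_subadd mP _ _))// le_fap.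
by rewrite leeD ?IH ?inner_content_ge.
Qed.

(** Compactness reduces countable covers of a closed set to finite ones. *)
Lemma inner_content_sigma_subadditive (U : nat -> set X) :
  (forall i, open (U i)) ->
  lambda (\bigcup_i U i) <= \sum_(i <oo) lambda (U i).
Proof.
move=> oU; apply: inner_content_le => K cK KU.
have : compact K by apply: subclosed_compact cX _.
rewrite compact_cover => /(_ nat setT U (fun i _ => oU i) KU)[D' _ KD].
pose N := (\max_(i <- finmap.enum_fset D') i)%N.
apply: (@le_trans _ _ (\sum_(0 <= i < N.+1) lambda (U i))).
  apply: fap_le_sum_inner => // x /KD[i /= iD Ux]; exists i => //=.
  by rewrite ltnS; exact: (@leq_bigmax_seq _ _ xpredT id).
by apply: nneseries_lim_ge => *; exact: inner_content_ge0.
Qed.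

Lemma outer_content0 : outer_content m set0 = 0.
Proof.
rewrite outer_content_open; last exact: open0.
apply/eqP; rewrite eq_le inner_content_ge0 andbT; apply: inner_content_le.
by move=> K _; rewrite subset0 => ->; rewrite fap_set0.
Qed.

Lemma outer_content_ge0 A : 0 <= outer_content m A.
Proof. by apply: outer_content_ge => U _ _; exact: inner_content_ge0. Qed.

Lemma le_outer_content : {homo outer_content m : A B / A `<=` B >-> A <= B}.
Proof.
move=> A B AB; apply: outer_content_ge => U oU BU.
by apply: outer_content_le => //; exact: subset_trans BU.
Qed.

Lemma outer_content_fin A : outer_content m A \is a fin_num.
Proof.
rewrite ge0_fin_numE ?outer_content_ge0// (@le_lt_trans _ _ 1) ?ltry//.
apply: le_trans (inner_content_le1 setT).
by apply: outer_content_le => //; exact: openT.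
Qed.

Lemma outer_content_sigma_subadditive : sigma_subadditive (outer_content m).
Proof.
move=> A; apply/lee_addgt0Pr => e e0.
have /choice[U UP] n : exists U, [/\ open U, A n `<=` U &
    lambda U <= outer_content m (A n) + (e / (2 ^ n.+1)%:R)%:E].
  have en0 : (0 < e / (2 ^ n.+1)%:R)%R by rewrite divr_gt0// ltr0n expn_gt0.
  have [_ [U [oU AU] <-] lU] :=
    lb_ereal_inf_adherent en0 (outer_content_fin (A n)).
  by exists U; split=> //; exact: ltW.
apply: le_trans (epsilon_trick _ _ (ltW e0)); last first.
  by move=> n; exact: outer_content_ge0.
apply: (@le_trans _ _ (lambda (\bigcup_n U n))).
  apply: outer_content_le; first by apply: bigcup_open => i _; case: (UP i).
  by apply: subset_bigcup => i _; case: (UP i).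
apply: le_trans (inner_content_sigma_subadditive _) _.
  by move=> i; case: (UP i).
apply: lee_nneseries => i *; first exact: inner_content_ge0.
by case: (UP i).
Qed.

HB.instance Definition _ := isOuterMeasure.Build R X (outer_content m)
  outer_content0 outer_content_ge0 le_outer_content
  outer_content_sigma_subadditive.

(** Inside an open [V], exhaust first [V `&` U] by a closed [K], then what is
    left of [V] outside [K] by a second closed set, disjoint from the first. *)
Lemma open_caratheodory (U : set X) :
  open U -> (outer_content m).-caratheodory U.
Proof.
move=> oU; apply: le_caratheodory_measurable => A.
apply: outer_content_ge => V oV AV.
apply: (@le_trans _ _ (lambda (V `&` U) + outer_content m (V `&` ~` U))).
  apply: leeD; last by apply: le_outer_content; exact: setSI.
  by apply: outer_content_le; [exact: openI|exact: setSI].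
rewrite -leeBrDr ?outer_content_fin//.
apply: inner_content_le => K cK KVU.
rewrite leeBrDr ?outer_content_fin// addeC -leeBrDr//.
apply: (@le_trans _ _ (lambda (V `\` K))).
  apply: outer_content_le; first by apply: openI => //; exact: closed_openC.
  by move=> x [Vx Ux]; split=> // /KVU[].
apply: inner_content_le => L cL LVK; rewrite leeBrDr// -EFinD -mU.
  apply: inner_content_ge; first exact: closedU.
  by move=> x [/LVK[]|/KVU[]].
by rewrite -subset0 => x [/LVK[]].
Qed.


Let borel := g_sigma_algebraType (@open X).

Let borel_caratheodory (A : set borel) :
  measurable A -> (outer_content m).-cara.-measurable A.
Proof.
move=> mA.
suff : <<s @open X >> `<=` (outer_content m).-cara.-measurable by apply.
apply: smallest_sub; first exact: sigma_algebra_measurable.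
exact: open_caratheodory.
Qed.

Let outer_content_sigma_additive :
  semi_sigma_additive (outer_content m : set borel -> \bar R).
Proof.
move=> F mF tF mUF.
have mcF i := borel_caratheodory (mF i).
exact: (caratheodory_measure_sigma_additive mcF tF (borel_caratheodory mUF)).
Qed.

HB.instance Definition _ := isMeasure.Build _ borel R
  (outer_content m : set borel -> \bar R)
  outer_content0 outer_content_ge0 outer_content_sigma_additive.

Let outer_content_setT : (outer_content m : set borel -> \bar R) setT = 1.
Proof.
rewrite outer_content_open; last exact: openT.
apply/eqP; rewrite eq_le inner_content_le1/=.
by have := inner_content_ge closedT (@subset_refl _ setT); case: mP => ->.
Qed.

HB.instance Definition _ := Measure_isProbability.Build _ _ R
  (outer_content m : set borel -> \bar R) outer_content_setT.

Lemma exists_regularization :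
  exists mu : probability (g_sigma_algebraType (@open X)) R,
    forall A, mu A = outer_content m A.
Proof. by exists (outer_content m : set borel -> \bar R). Qed.

(** A closed subset [K] of the preimage of [U] has a closed image in [U], by
    compactness, and [m K] is at most the mass of the preimage of that image. *)
Lemma inner_content_preimage (f : X -> X) (U : set X) : continuous f ->
  (forall A, m (f @^-1` A) = m A) -> lambda (f @^-1` U) = lambda U.
Proof.
move=> cf mf; apply/eqP; rewrite eq_le; apply/andP; split.
  apply: inner_content_le => K cK KU.
  have cpK : compact (f @` K).
    apply: continuous_compact; last exact: subclosed_compact cX _.
    exact: continuous_subspaceT.
  apply: (@le_trans _ _ (m (f @` K))%:E).
    by rewrite lee_fin -(mf (f @` K)) le_fap// => x Kx; exists x.
  apply: inner_content_ge; first exact: compact_closed.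
  by move=> _ [x Kx <-]; exact: KU.
apply: inner_content_le => K cK KU; rewrite -mf; apply: inner_content_ge.
  by move/continuous_closedP : cf; exact.
by move=> x /KU.
Qed.

End regularization.

(** Open sets are stable under intersection and generate the Borel sets. *)
Lemma borel_invariance (R : realType) (X : ptopologicalType) (f : X -> X)
    (mu : probability (g_sigma_algebraType (@open X)) R) : continuous f ->
  (forall U, open U -> mu U = mu (f @^-1` U)) ->
  forall B : set (g_sigma_algebraType (@open X)), measurable B ->
    mu B = mu (f @^-1` B).
Proof.
move=> cf muf.
pose T := g_sigma_algebraType (@open X).
have mf : measurable_fun setT (f : T -> T).
  apply: (@measurability _ _ T T setT f (@open X)) => //.
  move=> _ [U oU <-]; rewrite setTI; apply: sub_sigma_algebra.
  by move/continuousP : cf; apply.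
have mpre (B : set T) : measurable B -> measurable ((f : T -> T) @^-1` B).
  by move=> mB; rewrite -[X in measurable X]setTI; exact: mf.
apply: (@dynkin_induction _ T (@open X)
  (fun B => mu B = mu (f @^-1` B))) => //.
- by move=> A B; exact: openI.
- move=> S mS muS; rewrite preimage_setC !probability_setC//; last exact: mpre.
  by rewrite muS.
move=> F mF tF muF; rewrite preimage_bigcup !measure_semi_bigcup//.
- by apply: eq_eseriesr => i _; exact: muF.
- by move=> i; exact: mpre.
- apply/trivIsetP => i j _ _ ij; rewrite -preimage_setI.
  by move/trivIsetP : tF => ->//; rewrite preimage_set0.
- by apply: bigcup_measurable => i _; exact: mpre.
- exact: bigcup_measurable.
Qed.

(** Regularization keeps invariance, and can only increase the mass near a
    closed set. *)
Lemma exists_invariant_probability (R : realType) (X : ptopologicalType)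
    (f : X -> X) (m : set X -> R) :
  hausdorff_space X -> compact [set: X] -> continuous f ->
  finitely_additive_probability m -> (forall A, m (f @^-1` A) = m A) ->
  exists mu : probability (g_sigma_algebraType (@open X)) R,
    (forall B : set (g_sigma_algebraType (@open X)), measurable B ->
       mu B = mu (f @^-1` B)) /\
    (forall F U : set X, closed F -> open U -> F `<=` U ->
       ((m F)%:E <= mu U)%E).
Proof.
move=> hX cX cf mP mf; have [mu muE] := exists_regularization hX cX mP.
exists mu; split=> [|F U cF oU FU].
  apply: borel_invariance => // U oU; rewrite !muE.
  have oV : open (f @^-1` U) by move/continuousP : cf; apply.
  by rewrite !outer_content_open// inner_content_preimage.
by rewrite muE outer_content_open//; exact: inner_content_ge.
Qed.

(** * Limits of empirical frequencies *)

Lemma ultra_fmap (T U : Type) (u : T -> U) (F : set_system T) :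
  UltraFilter F -> UltraFilter (u @ F).
Proof.
move=> UF; split; first exact: fmap_proper_filter.
move=> G GF FG; apply/seteqP; split=> // A GA.
have [//|FnA] := in_ultra_setVsetC (u @^-1` A) UF.
by have /filter_ex[? []] : G (A `&` ~` A) by apply: filterI => //; exact: FG.
Qed.

Section visits.
Context (T : Type) (f : T -> T).

Definition visits (A : set T) (n : nat) (x : T) : nat :=
  \sum_(j < n) (iter j f x \in A).

Lemma visits_add A p n x :
  visits A (p + n) x = (visits A p x + visits A n (iter p f x))%N.
Proof.
rewrite /visits big_split_ord/=; congr addn; apply: eq_bigr => j _.
by rewrite -iterD addnC.
Qed.

Lemma visits_le A n x : (visits A n x <= n)%N.
Proof.
rewrite /visits -[leqRHS]card_ord -sum1_card leq_sum// => j _; exact: leq_b1.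
Qed.

Lemma visits_setT n x : visits setT n x = n.
Proof.
rewrite /visits (eq_bigr (fun=> 1%N)) ?sum1_card ?card_ord// => j _.
by rewrite in_setT.
Qed.

Lemma visitsU A B n x : A `&` B = set0 ->
  visits (A `|` B) n x = (visits A n x + visits B n x)%N.
Proof.
move=> AB0; rewrite -big_split/=; apply: eq_bigr => j _; rewrite in_setU.
case/boolP : (_ \in A) => [/set_mem jA|//].
case/boolP : (_ \in B) => [/set_mem jB|//].
by have : (A `&` B) (iter j f x) by []; rewrite AB0.
Qed.

(** Both sides count the visits during the first [n.+1] steps; hence the
    frequencies of a set and of its preimage have the same limit. *)
Lemma visits_preimage A n x :
  (visits (f @^-1` A) n x + (x \in A) = visits A n x + (iter n f x \in A))%N.
Proof.
transitivity (visits A n.+1 x).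
  rewrite /visits big_ord_recl/= addnC; congr addn; apply: eq_bigr => j _.
by rewrite /visits big_ord_recr.
Qed.

End visits.

Section krylov_bogoliubov.
Context (R : realType) (X : Type) (f : X -> X).
Variables (x_ : nat -> X) (n_ : nat -> nat).
Hypothesis n_ge : forall k, (k < n_ k)%N.

Definition frequency A k : R := (visits f A (n_ k) (x_ k))%:R / (n_ k)%:R.

Let n_gt0 k : 0 < (n_ k)%:R :> R.
Proof. by rewrite ltr0n (leq_trans _ (n_ge k)). Qed.

Lemma frequency_itv A k : 0 <= frequency A k <= 1.
Proof.
rewrite divr_ge0//= ler_pdivrMr// mul1r ler_nat; exact: visits_le.
Qed.

Lemma frequency_preimage A k :
  `|frequency (f @^-1` A) k - frequency A k| <= k.+1%:R^-1.
Proof.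
rewrite -mulrBl normrM normfV (ger0_norm (ltW (n_gt0 k))).
apply: (@le_trans _ _ (1 / (n_ k)%:R)); last first.
  by rewrite mul1r lef_pV2 ?posrE// ler_nat.
rewrite ler_pM2r ?invr_gt0//.
have /(congr1 (fun i : nat => i%:R : R)) := visits_preimage f A (n_ k) (x_ k).
rewrite !natrD => h.
rewrite (_ : _ - _ = (iter (n_ k) f (x_ k) \in A)%:R - (x_ k \in A)%:R);
  last first.
  by apply/eqP; rewrite subr_eq addrAC eq_sym subr_eq addrC -h.
by case: (_ \in A); case: (_ \in A);
  rewrite /= ?subrr ?subr0 ?sub0r ?normrN ?normr1 ?normr0.
Qed.

Section ultralimit.
Variable F : set_system nat.
Context {UF : UltraFilter F}.
Hypothesis ooF : \oo `<=` F.

Lemma ultra_cvg_itv (u : nat -> R) : (forall k, 0 <= u k <= 1) ->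
  cvg (u @ F).
Proof.
move=> u01.
have := @segment_compact R 0 1; rewrite compact_ultra.
move=> /(_ (u @ F) (ultra_fmap u UF))[].
  by apply: (@filterE _ F) => k; rewrite /= in_itv/= u01.
by move=> l [_ ul]; apply/cvg_ex; exists l.
Qed.

(** The ultrafilter makes the limit exist for all sets [A] at once. *)
Definition mean_frequency A : R := lim (frequency A @ F).

Lemma mean_frequency_cvg A : frequency A @ F --> mean_frequency A.
Proof. exact/ultra_cvg_itv/frequency_itv. Qed.

Lemma mean_frequency_ge A c :
  (forall k, c <= frequency A k) -> c <= mean_frequency A.
Proof.
move=> h; apply: limr_ge; first exact: mean_frequency_cvg.
exact: filterE.
Qed.

Lemma mean_frequency_fap : finitely_additive_probability mean_frequency.
Proof.
split.
- apply: cvg_lim => //.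
  rewrite (_ : frequency setT = cst 1); first exact: cvg_cst.
  by apply/funext => k; rewrite /frequency visits_setT divff// gt_eqF.
- by move=> A; apply: mean_frequency_ge => k; case/andP : (frequency_itv A k).
move=> A B AB; apply: cvg_lim => //.
rewrite (_ : frequency _ = frequency A \+ frequency B); last first.
  by apply/funext => k; rewrite /frequency visitsU// natrD mulrDl.
by apply: cvgD; exact: mean_frequency_cvg.
Qed.

Lemma mean_frequency_preimage A : mean_frequency (f @^-1` A) = mean_frequency A.
Proof.
apply/eqP; rewrite -subr_eq0; apply/eqP.
have /cvg_lim <- // : frequency (f @^-1` A) \- frequency A @ F -->
  mean_frequency (f @^-1` A) - mean_frequency A.
  by apply: cvgB; exact: mean_frequency_cvg.
apply: cvg_lim => //.
apply: (cvg_trans (G := frequency (f @^-1` A) \- frequency A @ \oo)).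
  exact: cvg_app.
apply/cvgr0Pnorm_le => e e0.
have := @cvg_harmonic R => /cvgr0Pnorm_le /(_ e e0).
apply: filterS => k /=; apply: le_trans.
rewrite (le_trans (frequency_preimage A k))//.
by rewrite /harmonic/= ler_norm.
Qed.

End ultralimit.
End krylov_bogoliubov.

(** * Visits to closed sets away from the measure center *)

Section measure_center.
Context (R : realType) (X : metricType R) (f : X -> X).
Hypotheses (cX : compact [set: X]) (cf : continuous f).

Lemma measure_centerP (x : X) : measure_center f x <->
  forall U : set X, open U -> U x ->
    exists (x0 : X) (mu : probability (borel_type x0) R),
      Defs.invariant f mu /\ (0 < mu U)%E.
Proof.
split=> [Yx U oU Ux|h].
  by apply: (measure_center_saturated oU); exists x.
by exists [set x] => // U oU [y [Uy yx]]; apply: h => //; rewrite -yx.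
Qed.

(** Each point of [C] has an open neighbourhood that is null for all invariant
    probabilities; finitely many of them cover [C]. *)
Lemma invariant_null_cover (C : set X) (x0 : X)
    (mu : probability (borel_type x0) R) :
  closed C -> C `&` measure_center f = set0 -> Defs.invariant f mu ->
  exists2 U, open U & C `<=` U /\ mu U = 0%E.
Proof.
move=> cC CY imu.
have /choice[U UP] (c : X) : exists U : set X,
    [/\ open U, mu U = 0%E & C c -> U c].
  have [Cc|nCc] := pselect (C c); last first.
    by exists set0; split => //; exact: open0.
  have /measure_centerP /existsNP[U] : ~ measure_center f c.
    by move=> Yc; have : (C `&` measure_center f) c by []; rewrite CY.
  move=> /not_implyP[oU /not_implyP[Uc nU]]; exists U; split => //.
  apply/eqP; rewrite eq_le measure_ge0 andbT leNgt; apply/negP => U0.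
  by apply: nU; exists x0, mu.
have : @compact (pointed_at x0) C by apply: subclosed_compact cC cX _.
rewrite compact_cover => /(_ X C U)[|c Cc|D' _ CD'].
- by move=> c _; case: (UP c).
- by exists c => //; case: (UP c) => _ _; apply.
pose V := \big[setU/set0]_(c <- finmap.enum_fset D') U c.
have [oV V0] : open V /\ mu V = 0%E.
  apply: (big_rec (fun A : set X => open A /\ mu A = 0%E)) => [|c A _ [oA A0]].
    by split; [exact: open0|exact: measure0].
  have [oU U0 _] := UP c; split; first exact: openU.
  by rewrite measureU0//; apply: sub_sigma_algebra.
exists V => //; split => //.
by move=> x /CD'[c /= cD Ux]; rewrite /V -bigcup_seq; exists c.
Qed.

(** If this failed, an invariant probability built from the offending orbit
    segments would give mass at least [1 / p] to every open set around [C]. *)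
Lemma visits_sublinear (C : set X) :
  closed C -> C `&` measure_center f = set0 ->
  forall p, exists N, forall n x, (N <= n)%N -> (p * visits f C n x <= n)%N.
Proof.
move=> cC CY p; apply: contrapT => /forallNP h.
have /choice[w wP] k : exists w : nat * X,
    (k < w.1)%N /\ (w.1 < p * visits f C w.1 w.2)%N.
  have /existsNP[n /existsNP[x /not_implyP[kn /negP]]] := h k.+1.
  by rewrite -ltnNge => nv; exists (n, x).
pose n_ k := (w k).1; pose x_ k := (w k).2.
have n_ge k : (k < n_ k)%N by case: (wP k).
have [F [UF ooF]] := ultraFilterLemma (@eventually_filter).
pose x0 : X := x_ 0.
pose m := @mean_frequency R X f x_ n_ F.
have mP : finitely_additive_probability m by exact: mean_frequency_fap.
have mf A : m (f @^-1` A) = m A by exact: mean_frequency_preimage.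
have hX : hausdorff_space X by exact: metric_hausdorff.
have [mu [imu muC]] :=
  @exists_invariant_probability R (pointed_at x0) f m hX cX cf mP mf.
have [U oU [CU U0]] := invariant_null_cover cC CY imu.
have := muC C U cC oU CU; rewrite U0 lee_fin leNgt => /negP; apply.
have p0 : (0 < p)%N by case: (wP 0) => _; case: (p).
apply: (@lt_le_trans _ _ (p%:R^-1)); first by rewrite invr_gt0 ltr0n.
apply: (mean_frequency_ge n_ge) => k.
rewrite /frequency ler_pdivlMr ?ltr0n ?(leq_trans _ (n_ge k))//.
rewrite mulrC ler_pdivrMr ?ltr0n// -natrM ler_nat mulnC.
by case: (wP k) => _ /ltnW.
Qed.

End measure_center.

(** * Sublinear functions *)

Section sublinear.

Definition sublinear (u : nat -> nat) : Prop :=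
  forall p, exists N, forall n, (N <= n)%N -> (p * u n <= n)%N.

Lemma sublinearP (R : realType) (u : nat -> nat) :
  (fun n : nat => (u n)%:R / n%:R : R) @ \oo --> (0 : R) <-> sublinear u.
Proof.
split=> [/cvgr0Pnorm_le h p|h].
  have /h[N _ hN] : 0 < p.+1%:R^-1 :> R by rewrite invr_gt0 ltr0n.
  exists N.+1 => n Nn; have := hN n (ltnW Nn).
  rewrite /= ger0_norm ?divr_ge0// ler_pdivrMr ?ltr0n; last lia.
  rewrite mulrC ler_pdivlMr ?ltr0n// -natrM ler_nat; lia.
apply/cvgr0Pnorm_le => e e0.
pose p := (Num.truncn e^-1).+1.
have [N hN] := h p; exists N.+1 => // n /= Nn.
have n0 : (0 < n)%N by lia.
rewrite ger0_norm ?divr_ge0// ler_pdivrMr ?ltr0n//.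
have : (p * u n)%:R <= n%:R :> R by rewrite ler_nat hN//; lia.
have ep : e^-1 <= p%:R :> R by apply: ltW; exact: truncnS_gt.
have : e^-1 * (u n)%:R <= p%:R * (u n)%:R by rewrite ler_wpM2r.
rewrite natrM => /le_trans /[apply]; rewrite mulrC ler_pdivrMr// mulrC.
by rewrite (mulrC e).
Qed.

(** The function [h] is the running maximum of the least good values.  When no
    value below [n] is good, [n] itself is taken, so that the maximum is always
    defined and only its values below [n] carry information. *)
Lemma sublinear_envelope (good : nat -> nat -> Prop) :
  (forall n c c', (c <= c')%N -> good n c -> good n c') ->
  (forall p, exists N, forall n, (N <= n)%N ->
     exists2 c, good n c & (p * c <= n)%N) ->
  exists h : nat -> nat,
    [/\ forall n, (0 < h n)%N, forall n, (h n <= h n.+1)%N, sublinear h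
      & forall n, (h n < n)%N -> good n (h n)].
Proof.
move=> good_mono good_sub.
have /choice[M MP] n : exists c, [/\ (c <= n)%N, (c < n)%N -> good n c &
    forall c', good n c' -> (c <= c')%N].
  pose P c := `[< c = n \/ good n c >].
  have exP : exists c, P c by exists n; apply/asboolP; left.
  case: (ex_minnP exP) => c /asboolP cP cmin; exists c; split.
  - by apply: cmin; apply/asboolP; left.
  - by case: cP => [->|//]; rewrite ltnn.
  - by move=> c' gc'; apply: cmin; apply/asboolP; right.
exists (fun n => maxn 1 (\max_(i < n.+1) M i)); split.
- by move=> n; rewrite leq_max.
- by move=> n; rewrite [X in (_ <= maxn _ X)%N]big_ord_recr/= maxnA leq_maxl.
- move=> [|p]; first by exists 0%N => n _; rewrite mul0n.
  have [N hN] := good_sub p.+1.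
  have MN n : (N <= n)%N -> (p.+1 * M n <= n)%N.
    move=> /hN[c gc]; apply: leq_trans; rewrite leq_mul2l.
    by case: (MP n) => _ _ /(_ _ gc) ->; rewrite orbT.
  exists (p.+1 * N.+1)%N => n Nn; rewrite mulnC -leq_divRL// geq_max.
  apply/andP; split; first by rewrite leq_divRL//; lia.
  apply/bigmax_leqP => i _; rewrite leq_divRL//; have := ltn_ord i.
  have [/MN|iN] := leqP N i; first by lia.
  by case: (MP i) => Mi _ _; nia.
move=> n hn; apply: (@good_mono n (M n)).
  rewrite leq_max; apply/orP; right.
  by rewrite (leq_bigmax (ord_max : 'I_n.+1)).
case: (MP n) => _ + _; apply; apply: leq_ltn_trans hn.
rewrite leq_max; apply/orP; right.
by rewrite (leq_bigmax (ord_max : 'I_n.+1)).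
Qed.

End sublinear.

(** * Tracing of finite lists of orbit segments *)

Section tracing.
Context (R : realType) (X : metricType R) (f : X -> X).

Definition mismatches (e : R) (n : nat) (x y : X) : nat :=
  \sum_(j < n) ~~ (mdist (iter j f x) (iter j f y) < e)%R.

Lemma mismatches_add e p n x y : mismatches e (p + n) x y =
  (mismatches e p x y + mismatches e n (iter p f x) (iter p f y))%N.
Proof.
rewrite /mismatches big_split_ord/=; congr addn; apply: eq_bigr => j _.
by rewrite -!iterD addnC.
Qed.

Lemma mismatches_le e n x y : (mismatches e n x y <= n)%N.
Proof.
rewrite /mismatches -[leqRHS]card_ord -sum1_card leq_sum// => j _.
exact: leq_b1.
Qed.

Lemma mismatches0 e n x y :
  (forall j, (j < n)%N -> mdist (iter j f x) (iter j f y) < e) ->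
  mismatches e n x y = 0%N.
Proof. by move=> h; rewrite /mismatches big1// => j _; rewrite h. Qed.

Lemma mismatches_sym e n x y : mismatches e n x y = mismatches e n y x.
Proof. by apply: eq_bigr => j _; rewrite metric_sym. Qed.

Lemma le_mismatches e e' n x y : e <= e' ->
  (mismatches e' n x y <= mismatches e n x y)%N.
Proof.
move=> ee'; apply: leq_sum => j _.
case: (ltP _ e) => [de|_]; last exact: leq_b1.
by rewrite (lt_le_trans de ee').
Qed.

Lemma mismatches_triangle e e' n x y z : (mismatches (e + e')%R n x z <=
  mismatches e n x y + mismatches e' n y z)%N.
Proof.
rewrite -big_split/=; apply: leq_sum => j _.
case: (ltP _ e) => [xy|_]; last exact: leq_trans (leq_b1 _) (leq_addr _ _).
case: (ltP _ e') => [yz|_]; last exact: leq_trans (leq_b1 _) (leq_addl _ _).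
by rewrite (le_lt_trans (metric_triangle _ (iter j f y) _))// ltrD.
Qed.

Lemma mistake_ballP (G : nat -> R -> nat) n x e y : 0 < e ->
  mistake_ball f G n x e y <-> (mismatches e n x y <= G n e)%N.
Proof.
move=> e0; pose D := [set j : 'I_n | mdist (iter j f x) (iter j f y) < e]%SET.
have DE : (mismatches e n x y = n - #|D|)%N.
  have -> : (n - #|D| = #|~: D|)%N by have := cardsC D; rewrite card_ord; lia.
  rewrite -sum1_card big_mkcond/=.
  by apply: eq_bigr => j _; rewrite !inE; case: (_ < e)%R.
rewrite DE; split=> [[A]|Dn].
  rewrite inE => nA Ae; suff : (#|A| <= #|D|)%N by lia.
  apply/subset_leq_card/fintype.subsetP => j jA; rewrite inE.
  apply: le_lt_trans Ae.
  exact: (le_bigmax_cond _ (fun i : 'I_n => mdist (iter i f x) (iter i f y))).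
exists D; first by rewrite inE leq_subLR addnC -leq_subLR.
by apply/bigmax_ltP; split=> // j; rewrite inE.
Qed.

(** A segment [(e, x, n)] asks to follow [n] points of the orbit of [x] at
    precision [e]. *)
Definition segment : Type := R * X * nat.

Definition total_length (s : seq segment) : nat := \sum_(t <- s) t.2.

Fixpoint traces (G : nat -> R -> nat) (s : seq segment) (z : X) : Prop :=
  if s is t :: s' then
    (mismatches t.1.1 t.2 t.1.2 z <= G t.2 t.1.1)%N /\
    traces G s' (iter t.2 f z)
  else True.

Lemma total_length_cons t s : total_length (t :: s) = (t.2 + total_length s)%N.
Proof. exact: big_cons. Qed.

Lemma traces_cat G s1 s2 z : traces G (s1 ++ s2) z <->
  traces G s1 z /\ traces G s2 (iter (total_length s1) f z).
Proof.
elim: s1 z => [|t s1 IH] z /=; first by rewrite /total_length big_nil; tauto.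
by rewrite IH total_length_cons addnC iterD; tauto.
Qed.

Lemma traces_nth G s t0 z : traces G s z <->
  forall j, (j < size s)%N -> let t := nth t0 s j in
    (mismatches t.1.1 t.2 t.1.2
       (iter (\sum_(i < j) (nth t0 s i).2) f z) <= G t.2 t.1.1)%N.
Proof.
elim: s z => [|t s IH] z /=; first by split.
rewrite IH; split=> [[h0 h] [|j] js|h].
- by rewrite big_ord0.
- by rewrite big_ord_recl/= addnC iterD; exact: h.
split; first by have := h 0%N isT; rewrite big_ord0.
move=> j js; have := h j.+1 js; rewrite big_ord_recl/= addnC iterD.
exact.
Qed.

(** The specification condition for the subsystem on [A], with distances and
    iterates taken in the ambient space. *)
Definition spec_on (A : set X) (G : nat -> R -> nat) (k : R -> nat) : Prop :=
  forall s : seq segment, s != [::] ->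
    (forall t, t \in s -> [/\ 0 < t.1.1, A t.1.2 & (k t.1.1 <= t.2)%N]) ->
    exists2 z, A z & traces G s z.

End tracing.

(** The embedding [phi] lets the same statement serve for the whole system and
    for its restriction to an invariant subset. *)
Lemma almost_specificationP (R : realType) (Z X : metricType R)
    (h : Z -> Z) (f : X -> X) (phi : Z -> X) :
  (forall a b, mdist (phi a) (phi b) = mdist a b) ->
  (forall a, phi (h a) = f (phi a)) ->
  almost_specification h <->
  exists (e0 : R) (g0 : nat -> R -> nat) (k : R -> nat),
    let g := extend_mistake e0 g0 in
    [/\ 0 < e0, mistake_function e0 g0,
        forall e, 0 < e ->
          (0 < k e)%N /\ forall n, (k e <= n)%N -> (g n e < n)%N
      & spec_on f (range phi) g k].
Proof.
move=> phid phih.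
have phi_iter j a : phi (iter j h a) = iter j f (phi a).
  by elim: j => //= j IH; rewrite phih IH.
have mE e n a b : mismatches h e n a b = mismatches f e n (phi a) (phi b).
  by apply: eq_bigr => j _; rewrite -!phi_iter phid.
split=> -[e0 [g0 [k [e0_gt0 g0P kP spec]]]]; exists e0, g0, k; split=> //.
  move=> s s0 sP; set g := extend_mistake e0 g0 in spec *.
  case: s s0 sP => // t0 s' _; set s := t0 :: s' => sP.
  have sj (j : 'I_(size s)) := sP _ (mem_nth t0 (ltn_ord j)).
  have /choice[x xP] (j : 'I_(size s)) : exists x, phi x = (nth t0 s j).1.2.
    by case: (sj j) => _ [x _ xE] _; exists x.
  have [//| | |z zP] := spec (size s) (fun j => (nth t0 s j).1.1) x
    (fun j => (nth t0 s j).2).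
  - by move=> j; case: (sj j).
  - by move=> j; case: (sj j).
  exists (phi z); first by exists z.
  apply/(traces_nth _ _ _ t0) => j js.
  have := zP (Ordinal js).
  have [e_gt0 _ _] := sj (Ordinal js).
  rewrite mistake_ballP// mE xP/= phi_iter.
  congr (mismatches _ _ _ _ (iter _ _ _) <= _)%N.
  by rewrite -(big_ord_widen _ (fun i => (nth t0 s i).2))// ltnW.
move=> m e x n m1 e_gt0 kn; set g := extend_mistake e0 g0 in spec *.
pose s : seq (segment X) := [seq (e j, phi (x j), n j) | j <- enum 'I_m].
have szs : size s = m by rewrite size_map size_enum_ord.
have [| |_ [z _ <-] zP] := spec s.
- by rewrite -size_eq0 szs -lt0n.
- by move=> _ /mapP[j _ ->]/=; split=> //; exists (x j).
exists z => j; rewrite mistake_ballP// mE phi_iter.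
pose t0 := (e j, phi (x j), n j).
have nths i : nth t0 s (i : 'I_m) = (e i, phi (x i), n i).
  by rewrite (nth_map i) ?size_enum_ord// nth_ord_enum.
move/(traces_nth _ _ _ t0)/(_ j) : zP; rewrite szs ltn_ord => /(_ isT).
rewrite nths/=; congr (mismatches _ _ _ _ (iter _ _ _) <= _)%N.
rewrite (big_ord_widen m (fun i => (nth t0 s i).2)) ?(ltnW (ltn_ord j))//.
by apply: eq_bigr => i _; rewrite nths.
Qed.

(** * From the space to the measure center *)

Section forward.
Context (R : realType) (X : metricType R) (f : X -> X).
Hypotheses (cX : compact [set: X]) (cf : continuous f).

Lemma continuous_iter j : continuous (iter j f).
Proof.
elim: j => [|j IH] x; first exact: cvg_id.
rewrite (_ : iter j.+1 f = f \o iter j f)//.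
by apply: continuous_comp; [exact: IH|exact: cf].
Qed.

Lemma near_mismatches (e : R) n z : 0 < e -> \forall w \near z,
  mismatches f e n w z = 0%N.
Proof.
move=> e0; have : \forall w \near z, forall j : 'I_n,
    mdist (iter j f z) (iter j f w) < e.
  apply: filter_forall => j.
  have : nbhs (iter j f z) (ball (iter j f z) e) by exact: nbhsx_ballx.
  by rewrite ballEmdist => /continuous_iter.
apply: filterS => w h; apply: mismatches0 => j jn.
by rewrite metric_sym; exact: (h (Ordinal jn)).
Qed.

Definition halve (t : segment X) : segment X := (t.1.1 / 2, t.1.2, t.2).

(** A limit of points that trace at half the precision traces at the full
    precision. *)
Lemma near_traces (G G' : nat -> R -> nat) (s : seq (segment X)) z :
  (forall n e, G' n e = G n (e / 2)) -> (forall t, t \in s -> 0 < t.1.1) ->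
  \forall w \near z, traces f G (map halve s) w -> traces f G' s z.
Proof.
move=> GG'; elim: s z => [|t s IH] z s0; first exact: nearW.
have t0 : 0 < t.1.1 / 2 by rewrite divr_gt0// s0// mem_head.
have s0' u : u \in s -> 0 < u.1.1 by move=> us; apply: s0; rewrite inE us orbT.
have h1 : \forall w \near z, traces f G (map halve s) (iter t.2 f w) ->
    traces f G' s (iter t.2 f z) := continuous_iter (IH (iter t.2 f z) s0').
apply: filterS2 h1 (near_mismatches t.2 z t0) => w h1 h2 /= [tw sw].
split; last exact: h1.
rewrite GG' [t.1.1 in leqLHS]splitr.
apply: leq_trans (mismatches_triangle _ _ _ _ _ w _) _.
by rewrite h2 addn0.
Qed.

Lemma visits_traces (G : nat -> R -> nat) (s : seq (segment X)) (C : set X) :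
  (0 < total_length s)%N -> (forall z, traces f G s z -> C z) ->
  forall K z, traces f G (flatten (nseq K s)) z ->
    (K <= visits f C (K * total_length s) z)%N.
Proof.
move=> s0 sC; elim=> [|K IH] z; first by rewrite /visits big_ord0.
rewrite /= traces_cat => -[zs zK].
rewrite mulSn visits_add -add1n leq_add//; last exact: IH.
rewrite -(subnKC s0) visits_add /visits big_ord1/=.
by rewrite (mem_set (sC z zs)).
Qed.

(** Tracing [N.+1] repetitions of the list makes one orbit visit the closure [C]
    of the set of tracing points with a frequency bounded below, so that [C]
    cannot avoid the measure center. *)
Lemma spec_on_measure_center (G G' : nat -> R -> nat) (k : R -> nat) :
  (forall n e, G' n e = G n (e / 2)) -> (forall e, 0 < e -> (0 < k e)%N) ->
  spec_on f setT G k ->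
  spec_on f (measure_center f) G' (fun e => k (e / 2)).
Proof.
move=> GG' k0 spec s s0 sP.
have s_pos t : t \in s -> 0 < t.1.1 by case/sP.
set hs := map halve s.
have tot0 : (0 < total_length hs)%N.
  case: s s0 sP @hs {s_pos} => // t s _ sP /=.
  rewrite total_length_cons addn_gt0/=.
  have [t0 _ kt] := sP t (mem_head _ _); rewrite (leq_trans _ kt)//.
  by rewrite k0// divr_gt0.
pose C := closure [set z | traces f G hs z].
have CY : C `&` measure_center f !=set0.
  apply: contrapT => /nonemptyPn CY0.
  have [N hN] :=
    visits_sublinear cX cf (@closed_closure _ _) CY0 (2 * total_length hs).
  have [| |z _ zP] := spec (flatten (nseq N.+1 hs)).
  - by case: (hs) tot0 => //; rewrite /total_length big_nil.
  - move=> t /flattenP[_ /nseqP[-> _]] /mapP[u /sP[u0 _ ku] ->]/=.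
    by split=> //; rewrite divr_gt0.
  have := visits_traces tot0 (@subset_closure _ _) zP.
  have := hN (N.+1 * total_length hs)%N z; rewrite -/C; nia.
case: CY => y [Cy Yy]; exists y => //.
have [w [ws yw]] := Cy _ (near_traces y GG' s_pos).
exact: yw.
Qed.
End forward.

(** * From the measure center to the space *)

Section backward.
Context (R : realType) (X : metricType R) (f : X -> X).
Hypotheses (cX : compact [set: X]) (cf : continuous f).

Fixpoint defects (s : seq (segment X)) (x : X) : nat :=
  if s is t :: s' then
    (mismatches f t.1.1 t.2 t.1.2 x + defects s' (iter t.2 f x))%N
  else 0%N.

Definition followed (A : set X) (e : R) (N : nat) : set X :=
  [set x | exists2 y, A y &
    forall j, (j < N)%N -> mdist (iter j f y) (iter j f x) < e].

Lemma open_followed (A : set X) (e : R) (N : nat) : open (followed A e N).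
Proof.
rewrite openE => x [y Ay yx].
have : \forall w \near x, forall j : 'I_N,
    mdist (iter j f y) (iter j f w) < e.
  apply: filter_forall => j.
  pose r := e - mdist (iter j f y) (iter j f x).
  have : nbhs (iter j f x) (ball (iter j f x) r).
    by apply: nbhsx_ballx; rewrite subr_gt0 yx.
  rewrite ballEmdist => /(continuous_iter cf) h.
  have {}h : \forall w \near x, mdist (iter j f x) (iter j f w) < r by exact: h.
  apply: filterS h => w xw.
  apply: le_lt_trans (metric_triangle _ (iter j f x) _) _.
  by rewrite addrC -ltrBrDr.
apply: filterS => w yw; exists y => // j jN; exact: (yw (Ordinal jN)).
Qed.

(** The list is built along the orbit of [x], whose current block is the one
    started by [y] and has reached length [t].  At a point of [followed A e N] a
    new block starts; at any other point the current block is prolonged, at the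
    price of one mismatch.  The last block swallows the fewer than [N] remaining
    steps. *)
Lemma cut_blocks (A : set X) (e : R) (N : nat) : (0 < N)%N ->
  forall n t y x, A y -> (N <= t)%N -> exists s : seq (segment X),
    [/\ s != [::],
        forall u, u \in s -> [/\ u.1.1 = e, A u.1.2 & (N <= u.2)%N],
        total_length s = (t + n)%N
      & (defects s x <=
         mismatches f e t y x +
         visits f (~` followed A e N) n (iter t f x) + N)%N].
Proof.
move=> N0; elim/ltn_ind => n IH t y x Ay Nt.
have [nN|Nn] := ltnP n N.
  exists [:: (e, y, (t + n)%N)]; split=> //.
  - move=> u; rewrite inE => /eqP ->; split=> //=.
    exact: leq_trans (leq_addr _ _).
  - by rewrite /total_length big_seq1.
  rewrite /= addn0 mismatches_add -addnA leq_add2l.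
  apply: leq_trans (leq_addl _ _); apply: leq_trans (ltnW nN).
  exact: mismatches_le.
have [[y' Ay' yx']|nU] := pselect (followed A e N (iter t f x)).
  have [|s [s0 sP sn sd]] := IH (n - N)%N _ N y' (iter t f x) Ay' (leqnn N).
    by lia.
  exists ((e, y, t) :: s); split=> //.
  - by move=> u; rewrite inE => /predU1P[->//|/sP].
  - by rewrite total_length_cons sn/=; lia.
  rewrite /= -addnA leq_add2l; apply: leq_trans sd _.
  rewrite mismatches0//; rewrite add0n leq_add2r.
  by rewrite -[in leqRHS](subnKC Nn) visits_add leq_addl.
case: n => [|n] in IH Nn *; first by lia.
have [|s [s0 sP sn sd]] := IH n (ltnSn n) (t + 1)%N y x Ay.
  by lia.
exists s; split=> //; first by lia.
apply: leq_trans sd _; rewrite leq_add2r mismatches_add -addnA leq_add2l.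
rewrite -(add1n n) visits_add leq_add//; last by rewrite addn1.
rewrite /visits big_ord1/= (mem_set (A := ~` followed A e N))//.
exact: mismatches_le.
Qed.

(** Errors add up along a list: those of the tracing point with respect to the
    list and those of the list with respect to the orbit of [x]. *)
Lemma tracing_defects (G : nat -> R -> nat) (e : R) (s : seq (segment X)) x z :
  (forall t, t \in s -> t.1.1 = e) -> traces f G s z ->
  (mismatches f (e + e) (total_length s) x z <=
   \sum_(t <- s) G t.2 e + defects s x)%N.
Proof.
elim: s x z => [|t s IH] x z se /=.
  by rewrite /total_length big_nil /mismatches big_ord0.
rewrite total_length_cons mismatches_add big_cons => -[].
have -> : t.1.1 = e by apply: se; rewrite mem_head.
move=> tz sz; rewrite addnACA leq_add//; last first.
  by apply: IH => // u us; apply: se; rewrite inE us orbT.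
apply: leq_trans (mismatches_triangle _ _ _ _ _ t.1.2 _) _.
by rewrite addnC leq_add// mismatches_sym.
Qed.

Lemma measure_center_nonempty (x : X) : measure_center f !=set0.
Proof.
apply: contrapT => /nonemptyPn Y0.
have [||N /(_ N.+1 x)] := visits_sublinear cX cf (C := setT) _ _ 2.
- exact: closedT.
- by rewrite Y0 setI0.
by rewrite visits_setT; lia.
Qed.

(** By [tracing_defects] the sum in the last clause bounds the errors, with
    respect to the orbit of [x], of any point that traces the list. *)
Definition shadowed (G : nat -> R -> nat) (k : R -> nat) (e : R) (n c : nat) :=
  forall x, exists s : seq (segment X),
    [/\ s != [::],
        forall t, t \in s ->
          [/\ t.1.1 = e, measure_center f t.1.2 & (k e <= t.2)%N],
        total_length s = n
      & (\sum_(t <- s) G t.2 e + defects s x <= c)%N].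

(** Cut into blocks so long that each has relatively few errors; besides these,
    there are only the visits outside the open set [followed Y e N] and at most
    [2 * N] errors at the two ends. *)
Lemma shadowed_sublinear (G : nat -> R -> nat) (k : R -> nat) (e : R) :
  0 < e -> sublinear (G ^~ e) ->
  forall p, exists N, forall n, (N <= n)%N ->
    exists2 c, shadowed G k e n c & (p * c <= n)%N.
Proof.
move=> e0 Ge p.
(* Tracing errors, visits outside [U] and the two ends contribute at most
   [n / q] each, three quarters of [n / p.+1] in total. *)
pose q := (4 * p.+1)%N.
have [N1 hN1] := Ge q.
pose N := maxn N1 (k e).+1.
pose Y := measure_center f.
pose U := followed Y e N.
have UY : ~` U `&` Y = set0.
  rewrite -subset0 => y [+ Yy]; apply; exists y => // j _.
  by rewrite mdistxx.
have [N2 hN2] :=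
  visits_sublinear cX cf (open_closedC (@open_followed Y e N)) UY q.
exists (N2 + N + 2 * q * N)%N => n Nn; exists (n %/ p.+1)%N; last first.
  by rewrite mulnC (leq_trans _ (leq_divM n p.+1))// leq_mul.
move=> x; have [y Yy] := measure_center_nonempty x.
have N0 : (0 < N)%N by rewrite /N; lia.
have [s [s0 sP sn sd]] := cut_blocks e N0 (n - N) x Yy (leqnn N).
rewrite -/Y -/U in sd.
exists s; split=> //.
- by move=> t /sP[-> Yt Nt]; split=> //; move: Nt; rewrite /N; lia.
- by rewrite sn; lia.
rewrite leq_divRL//.
have sG : (q * \sum_(t <- s) G t.2 e <= total_length s)%N.
  rewrite big_distrr/= /total_length big_seq [leqRHS]big_seq.
  rewrite leq_sum// => t /sP[_ _ Nt].
  by apply: hN1; exact: leq_trans (leq_maxl _ _) Nt.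
have Nn' : (N <= n)%N by lia.
have sd' : (defects s x <= N + visits f (~` U) n x + N)%N.
  apply: leq_trans sd _; rewrite leq_add2r leq_add ?mismatches_le//.
  by rewrite -[in leqRHS](subnKC Nn') visits_add leq_addl.
have : (q * defects s x <= q * N + q * visits f (~` U) n x + q * N)%N.
  by rewrite -!mulnDr leq_mul2l sd' orbT.
have : (q * visits f (~` U) n x <= n)%N by apply: hN2; lia.
move: sG; rewrite sn subnKC//; set S := \sum_(t <- s) _ => sG.
have -> : ((S + defects s x) * p.+1 <= n =
    (q * S + q * defects s x <= 4 * n))%N.
  by rewrite -mulnDr /q -mulnA leq_pmul2l// mulnC.
clearbody q; lia.
Qed.

(** Each segment is replaced by the blocks that shadow it at half its precision;
    the concatenated list is then traced in the measure center. *)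
Lemma spec_on_setT (e0 : R) (g0 : nat -> R -> nat) (k : R -> nat) :
  0 < e0 -> mistake_function e0 g0 ->
  spec_on f (measure_center f) (extend_mistake e0 g0) k ->
  exists (h0 : nat -> R -> nat) (k' : R -> nat),
    [/\ mistake_function e0 h0,
        forall e, 0 < e -> (0 < k' e)%N /\
          forall n, (k' e <= n)%N -> (extend_mistake e0 h0 n e < n)%N
      & spec_on f setT (extend_mistake e0 h0) k'].
Proof.
move=> e0_gt0 g0P spec; set G := extend_mistake e0 g0 in spec.
have /choice[h hP] (e : R) : exists h : nat -> nat, 0 < e ->
    [/\ forall n, (0 < h n)%N, forall n, (h n <= h n.+1)%N, sublinear h
      & forall n, (h n < n)%N -> shadowed G k (e / 2) n (h n)].
  have [e_gt0|_] := ltP 0 e; last by exists id.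
  have e2 : 0 < e / 2 by rewrite divr_gt0.
  have [||h hP] := @sublinear_envelope (shadowed G k (e / 2)); last by exists h.
    move=> n c c' cc' sc x; have [s [? ? ? sd]] := sc x.
    by exists s; split=> //; exact: leq_trans cc'.
  apply: shadowed_sublinear => //.
  have [|_ _ /sublinearP//] := g0P (Num.min (e / 2) e0).
  by rewrite lt_min e2 e0_gt0 ge_min lexx orbT.
pose h0 n e := h e n.
have e'_gt0 e : 0 < e -> 0 < Num.min e e0 by rewrite lt_min e0_gt0 andbT.
have /choice[k' k'P] (e : R) : exists k' : nat, 0 < e -> (0 < k')%N /\
    forall n, (k' <= n)%N -> (extend_mistake e0 h0 n e < n)%N.
  have [/e'_gt0/hP[h_gt0 _ hsub _]|_] := ltP 0 e; last by exists 0%N.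
  have [N hN] := hsub 2; exists N.+1 => _; split=> // n Nn.
  apply: leq_trans (hN n (ltnW Nn)).
  by rewrite mul2n -addnn -[ltnLHS]addn0 ltn_add2l h_gt0.
exists h0, k'; split=> //.
  move=> e /andP[e_gt0 _]; have [h1 h2 h3 _] := hP e e_gt0; split=> //.
  exact/sublinearP.
move=> s s0 sP.
suff [s' [s'0 s'P s's]] : exists s' : seq (segment X),
    [/\ s' != [::],
        forall t, t \in s' ->
          [/\ 0 < t.1.1, measure_center f t.1.2 & (k t.1.1 <= t.2)%N]
      & forall z, traces f G s' z -> traces f (extend_mistake e0 h0) s z].
  by have [z _ /s's zs] := spec _ s'0 s'P; exists z.
have one t : [/\ 0 < t.1.1, True & (k' t.1.1 <= t.2)%N] ->
    exists s' : seq (segment X), [/\ s' != [::],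
        forall t, t \in s' ->
          [/\ 0 < t.1.1, measure_center f t.1.2 & (k t.1.1 <= t.2)%N],
        total_length s' = t.2
      & forall z, traces f G s' z ->
          (mismatches f t.1.1 t.2 t.1.2 z <= extend_mistake e0 h0 t.2 t.1.1)%N].
  move=> [t0 _ kt]; have [_ /(_ _ kt) ht] := k'P _ t0.
  have [_ _ _ /(_ _ ht)/(_ t.1.2)] := hP _ (e'_gt0 _ t0).
  set e := Num.min t.1.1 e0 => -[s' [s'0 s'P s'n s'd]].
  exists s'; split=> //.
    move=> u /s'P[ue Yu ku]; rewrite ue; split=> //.
    by rewrite divr_gt0// e'_gt0.
  move=> z s'z; apply: leq_trans s'd.
  have s'e u : u \in s' -> u.1.1 = e / 2 by case/s'P.
  have := tracing_defects t.1.2 s'e s'z.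
  rewrite -splitr s'n; apply: leq_trans.
  by apply: le_mismatches; rewrite ge_min lexx.
elim: s s0 sP => // t s IH _ sP.
have [s1 [s10 s1P s1n s1z]] := one t (sP t (mem_head _ _)).
have [s_nil|s0] := eqVneq s [::].
  by exists s1; split=> // z /s1z; rewrite s_nil.
have [|s2 [s20 s2P s2z]] := IH s0.
  by move=> u us; apply: sP; rewrite inE us orbT.
exists (s1 ++ s2); split.
- by case: (s1) s10.
- by move=> u; rewrite mem_cat => /orP[/s1P|/s2P].
- move=> z; rewrite traces_cat s1n => -[/s1z ? /s2z ?]; by split.
Qed.

End backward.

Theorem theorem6p7 (R : realType) (X : metricType R) (f : X -> X)
    (cX : compact [set: X]) (cf : continuous f) :
  almost_specification f <->
  almost_specification (restrict_self (measure_center_stable cf)).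
Proof.
have XP := @almost_specificationP R X X f f id (fun _ _ => erefl)
  (fun _ => erefl).
have YP := @almost_specificationP R _ X
  (restrict_self (measure_center_stable cf)) f \val (fun _ _ => erefl)
  (fun _ => erefl).
have rY : range (\val : measure_center f -> X) = measure_center f.
  apply/seteqP; split=> [_ [y _ <-]|y Yy]; first exact: set_valP.
  by exists (SigSub (mem_set Yy)).
rewrite {}XP {}YP rY image_id.
split=> -[e0 [g0 [k [e0_gt0 g0P kP spec]]]]; last first.
  have [h0 [k' [h0P k'P spec']]] := spec_on_setT cX cf e0_gt0 g0P spec.
  by exists e0, h0, k'.
exists (2 * e0), (fun n e => g0 n (e / 2)), (fun e => k (e / 2)).
have GG' n e : extend_mistake (2 * e0) (fun n e => g0 n (e / 2)) n e =
    extend_mistake e0 g0 n (e / 2).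
  rewrite /extend_mistake; congr (g0 n _).
  by rewrite minr_pMl ?invr_ge0// (mulrC 2) mulfK.
split=> //.
- by rewrite mulr_gt0.
- move=> e /andP[e_gt0 ee0]; apply: g0P.
  by rewrite divr_gt0//= ler_pdivrMr// mulrC.
- move=> e e_gt0; have [] := kP (e / 2); first by rewrite divr_gt0.
  by move=> k1 k2; split=> // n; rewrite GG'; exact: k2.
apply: spec_on_measure_center spec => //.
by move=> e /kP[].
Qed.
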